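(* For any $d\ge1$ there exists a constant $C_d$ such that for every $M\in S_d^+$, $$\int_{\mathcal O_d}\lambda_d(R^{T}MR)\,dR\le C_d(\det M)^{\frac1{2d}},$$ where $\mathcal O_d$ is the group of $d\times d$ orthogonal matrices equipped with its Haar probability measure.
   Context: $S_d^+$ is the set of $d\times d$ symmetric positive definite matrices; $\|u\|_M:=\sqrt{u^TMu}$. The successive Minkowski minima of $M\in S_d^+$ are, for $1\le i\le d$, $\lambda_i(M):=\min\{\|u_i\|_M;\ (u_1,\dots,u_i)\in(\mathbb Z^d)^i \text{ linearly independent},\ \|u_1\|_M\le\dots\le\|u_i\|_M\}$. *)

(* Defs.v *)
From HB Require Import structures.
From mathcomp Require Import all_boot all_order all_algebra.
From mathcomp Require Import all_classical all_reals all_analysis.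
Set Implicit Arguments. Unset Strict Implicit. Unset Printing Implicit Defensive.
Import Order.TTheory GRing.Theory Num.Theory numFieldNormedType.Exports.
Local Open Scope classical_set_scope.
Local Open Scope ring_scope.

Section Defs.
Variable R : realType.

Definition spd {d : nat} (M : 'M[R]_d) : Prop :=
  M^T = M /\ forall x : 'rV[R]_d, x != 0 -> 0 < (x *m M *m x^T) 0 0.

Definition mnorm {d : nat} (M : 'M[R]_d) (u : 'rV[R]_d) : R :=
  Num.sqrt ((u *m M *m u^T) 0 0).

Definition intvec {d : nat} (z : 'rV[int]_d) : 'rV[R]_d := map_mx (fun k => k%:~R) z.

(* i-th successive Minkowski minimum lambda_i(M):
   min of ||u_i||_M over linearly independent (u_1,...,u_i) in (Z^d)^i
   with ||u_1||_M <= ... <= ||u_i||_M  (the minimum is attained; we write inf). *)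
Definition succ_min {d : nat} (M : 'M[R]_d) (i : nat) : R :=
  inf [set r : R | exists u : 'I_i -> 'rV[int]_d,
        [/\ row_free (\matrix_(j < i) intvec (u j)),
            (forall j k : 'I_i, (j <= k)%N ->
                mnorm M (intvec (u j)) <= mnorm M (intvec (u k))) &
            exists k : 'I_i, k.+1 = i /\ r = mnorm M (intvec (u k))]].

Definition orthog_grp (d : nat) : set 'M[R]_d := [set Q | Q^T *m Q = 1%:M].

Definition borelM (d : nat) := g_sigma_algebraType (@open 'M[R]_d).

(* Haar probability measure of O_d, viewed as a Borel measure on matrices
   concentrated on O_d: probability, full mass on O_d, and invariant under
   left multiplication by orthogonal matrices. (On the compact group O_d
   this characterizes the Haar probability measure uniquely.) *)
Definition haar_prob (d : nat)
  (mu : {measure set (borelM d) -> \bar R}) : Prop :=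
  [/\ mu setT = 1%E,
      mu (@orthog_grp d) = 1%E &
      forall Q : 'M[R]_d, @orthog_grp d Q ->
        forall A : set (borelM d), measurable A ->
          mu ((fun X : 'M[R]_d => Q *m X) @^-1` A) = mu A].

End Defs.
Arguments orthog_grp : clear implicits.

(* Main.v *)
Require Import Defs.
From HB Require Import structures.
From mathcomp Require Import all_boot all_order all_algebra.
From mathcomp Require Import all_classical all_reals all_analysis.
From mathcomp Require Import perm measurable_realfun ring lra zify.
Set Implicit Arguments. Unset Strict Implicit. Unset Printing Implicit Defensive.
Import Order.TTheory GRing.Theory Num.Theory numFieldNormedType.Exports.
Local Open Scope classical_set_scope.
Local Open Scope ring_scope.

(* The dual statement of the bound on the last minimum is: there is a nonzero integer vector z
   with lambda_d(N) |x.z| <= 2^(d-1) ||x||_N for all x (reduction theory, by induction on d,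
   choosing a nearly shortest first basis vector and passing to the Schur complement). For
   N = X^T M X this says that Xz lies in a dual ellipsoid; after a rotation Q such that the
   product of the diagonal entries m_i of Q M Q^T is at most 2^d det M, the event
   lambda_d > T implies |(QXz)_i| <= e_i := 2^(d-1) sqrt(m_i) / T for all i. Since X is
   Haar distributed and some coordinate j of QXz is at least 2^l / d, where 2^l is the order of
   magnitude of z, a packing argument with plane rotations bounds the probability of this
   by a constant times the product of the e_i / 2^l over i <> j. There are about 2^(l d) such z
   and only those l with 2^l <= d e_j contribute, so the sum over z and j is O(prod_i e_i), i.e.
   P(lambda_d > T) = O(sqrt(det M) / T^d). Summing over dyadic T >= (det M)^(1/(2d)) gives the
   bound on the mean when d >= 2; when d = 1, lambda_1 itself is bounded. *)

(** * Positive definite quadratic forms and Schur complements *)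

Section QuadraticForms.
Variable R : realType.

Definition dotp {n} (x y : 'rV[R]_n) : R := (x *m y^T) 0 0.
Definition qform {n} (M : 'M[R]_n) (x : 'rV[R]_n) : R := (x *m M *m x^T) 0 0.

Lemma dotpE n (x y : 'rV[R]_n) : dotp x y = \sum_i x 0 i * y 0 i.
Proof. by rewrite /dotp mxE; apply: eq_bigr => i _; rewrite mxE. Qed.

Lemma dotpC n (x y : 'rV[R]_n) : dotp x y = dotp y x.
Proof. by rewrite !dotpE; apply: eq_bigr => i _; rewrite mulrC. Qed.

Lemma dotpBl n (x y z : 'rV[R]_n) : dotp (x - y) z = dotp x z - dotp y z.
Proof. by rewrite /dotp mulmxBl !mxE. Qed.

Lemma dotpBr n (x y z : 'rV[R]_n) : dotp z (x - y) = dotp z x - dotp z y.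
Proof. by rewrite dotpC dotpBl !(dotpC z). Qed.

Lemma dotpZl n a (x y : 'rV[R]_n) : dotp (a *: x) y = a * dotp x y.
Proof. by rewrite /dotp -scalemxAl !mxE. Qed.

Lemma dotpZr n a (x y : 'rV[R]_n) : dotp y (a *: x) = a * dotp y x.
Proof. by rewrite dotpC dotpZl dotpC. Qed.

Lemma dotp0l n (x : 'rV[R]_n) : dotp 0 x = 0.
Proof. by rewrite /dotp mul0mx mxE. Qed.

Lemma dotp_ge0 n (x : 'rV[R]_n) : 0 <= dotp x x.
Proof. by rewrite dotpE sumr_ge0 // => i _; rewrite -expr2 sqr_ge0. Qed.

Lemma dotp_gt0 n (x : 'rV[R]_n) : x != 0 -> 0 < dotp x x.
Proof.
move=> x0; rewrite lt_neqAle dotp_ge0 andbT eq_sym; apply: contra x0.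
rewrite dotpE psumr_eq0 => [/allP h|i _]; last by rewrite -expr2 sqr_ge0.
apply/eqP/rowP => i; rewrite mxE; apply/eqP.
by have := h i (mem_index_enum i); rewrite mulf_eq0 orbb.
Qed.

Lemma qform_congr n m (B : 'M[R]_(m, n)) (M : 'M[R]_n) (x : 'rV[R]_m) :
  qform (B *m M *m B^T) x = qform M (x *m B).
Proof. by rewrite /qform trmx_mul !mulmxA. Qed.

Lemma qformE n (M : 'M[R]_n) (x : 'rV[R]_n) : qform M x = dotp (x *m M) x.
Proof. by []. Qed.

Lemma qform0 n (M : 'M[R]_n) : qform M 0 = 0.
Proof. by rewrite qformE mul0mx dotp0l. Qed.

Lemma qform_row n m (B : 'M[R]_(m, n)) (M : 'M[R]_n) i :
  qform M (row i B) = (B *m M *m B^T) i i.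
Proof.
rewrite /qform -row_mul tr_row -row_mul !mxE.
by apply: eq_bigr => k _; rewrite !mxE.
Qed.

Lemma qform1 n (x : 'rV[R]_n) : qform 1%:M x = dotp x x.
Proof. by rewrite /qform mulmx1. Qed.

Lemma spd_ge0 n (M : 'M[R]_n) x : spd M -> 0 <= qform M x.
Proof.
case=> _ h; have [->|x0] := eqVneq x 0; first by rewrite /qform mul0mx mul0mx mxE.
exact/ltW/h.
Qed.

Lemma spd_congr n (B M : 'M[R]_n) : B \in unitmx -> spd M -> spd (B *m M *m B^T).
Proof.
move=> uB [sM h]; split; first by rewrite !trmx_mul trmxK sM mulmxA.
move=> x x0; rewrite -/(qform _ _) qform_congr; apply: h.
by apply: contra x0 => /eqP e; rewrite -(mulmxK uB x) e mul0mx.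
Qed.

Lemma spd_unitmx n (M : 'M[R]_n) : spd M -> M \in unitmx.
Proof.
case=> _ h; rewrite -row_free_unit -kermx_eq0; apply/eqP/row_matrixP => i.
rewrite row0; apply/eqP; apply/negPn/negP => /h.
by rewrite -row_mul mulmx_ker row0 mul0mx mxE ltxx.
Qed.

(** At [qform M y *: x - t *: y] the form is nonnegative, and it equals [qform M y] times the
    difference of the two sides. *)
Lemma cauchy_schwarz n (M : 'M[R]_n) x y : spd M ->
  dotp (x *m M) y ^+ 2 <= qform M x * qform M y.
Proof.
move=> sM; have [->|y0] := eqVneq y 0.
  by rewrite /qform /dotp trmx0 !mulmx0 !mxE expr0n mulr0.
have qy : 0 < qform M y by apply: (proj2 sM).
set t := dotp _ _.
have tE : dotp (y *m M) x = t.
  by rewrite dotpC /dotp trmx_mul (proj1 sM) mulmxA.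
have := @spd_ge0 n M (qform M y *: x - t *: y) sM.
have -> : qform M (qform M y *: x - t *: y) =
   qform M y * (qform M x * qform M y - t ^+ 2).
  rewrite [LHS]qformE mulmxBl -!scalemxAl dotpBl !dotpBr !dotpZl !dotpZr tE.
  by rewrite -/t -!qformE; ring.
by rewrite pmulr_rge0 // subr_ge0.
Qed.

(** Coordinate i of x is the M-product of x with row i of [invmx M], so Cauchy-Schwarz bounds its
    square by a multiple of [qform M x]. Using [1 + s] keeps the constant positive in dimension 0
    too. *)
Lemma spd_coercive n (M : 'M[R]_n) : spd M ->
  exists2 c, 0 < c & forall x, c * dotp x x <= qform M x.
Proof.
move=> sM; have uM := spd_unitmx sM.
pose s := \sum_i qform M (row i (invmx M)).
have s0 : 0 <= s by apply: sumr_ge0 => i _; exact: spd_ge0.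
exists (1 + s)^-1; first by rewrite invr_gt0; lra.
move=> x; rewrite mulrC ler_pdivrMr; last lra.
suff : dotp x x <= s * qform M x by have := spd_ge0 x sM; lra.
rewrite dotpE mulr_suml; apply: ler_sum => i _.
have := cauchy_schwarz (row i (invmx M)) x sM.
rewrite -row_mul mulVmx // /dotp rowE mulmx1 -rowE !mxE.
by rewrite expr2.
Qed.

(** Minimizers up to a factor 2 serve both inductions below, on short lattice vectors and on
    Rayleigh quotients. *)
Lemma ex_near_min (S : set R) (c : R) : 0 < c -> S !=set0 -> lbound S c ->
  exists2 x, S x & forall y, S y -> x <= 2 * y.
Proof.
move=> c0 S0 lS.
have hl : has_lbound S by exists c.
have i0 : 0 < inf S by apply: lt_le_trans c0 _; exact: lb_le_inf.
have [x Sx xlt] := inf_adherent i0 (conj S0 hl).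
by exists x => // y Sy; have := ge_inf hl Sy; lra.
Qed.

Lemma dotp_row_mx m n (u v : 'rV[R]_m) (x y : 'rV[R]_n) :
  dotp (row_mx u x) (row_mx v y) = dotp u v + dotp x y.
Proof. by rewrite /dotp tr_row_mx mul_row_col mxE. Qed.

Lemma dotp_scalar (s t : R) : dotp (s%:M : 'rV[R]_1) t%:M = s * t.
Proof. by rewrite dotpE big_ord1 !mxE !mulr1n. Qed.

Lemma dotpDl n (x y z : 'rV[R]_n) : dotp (x + y) z = dotp x z + dotp y z.
Proof. by rewrite /dotp mulmxDl !mxE. Qed.

Lemma mul_tr_dotp n (x y : 'rV[R]_n) : x *m y^T = (dotp x y)%:M.
Proof. exact: mx11_scalar. Qed.

(** Completing the square in the first coordinate leaves the form of the Schur complement. *)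
Lemma qform_block n (a : R) (b : 'rV[R]_n) (M : 'M[R]_n) (t : R) (y : 'rV[R]_n) :
  a != 0 ->
  qform (block_mx a%:M b b^T M : 'M[R]_(1 + n)) (row_mx t%:M y) =
  a * (t + dotp y b / a) ^+ 2 + qform (M - a^-1 *: (b^T *m b)) y.
Proof.
move=> a0; rewrite !qformE mul_row_block mulmxBr -scalemxAr mulmxA mul_tr_dotp.
rewrite -scalar_mxM -raddfD /= !mul_scalar_mx dotp_row_mx dotp_scalar.
rewrite dotpBl !dotpDl !dotpZl (dotpC b); by field.
Qed.

Lemma spd_blockE n (M : 'M[R]_(1 + n)) : spd M ->
  M = block_mx (M 0 0)%:M (ursubmx M) (ursubmx M)^T (drsubmx M).
Proof.
move=> [sM _]; rewrite -{1}[M]submxK trmx_ursub sM; congr block_mx.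
by rewrite [LHS]mx11_scalar !mxE; congr (M _ _)%:M; apply: val_inj.
Qed.

Lemma spd_pivot n (M : 'M[R]_(1 + n)) : spd M -> 0 < M 0 0.
Proof.
move=> [_ h]; have := h (row 0 1%:M).
rewrite -/(qform _ _) qform_row trmx1 mulmx1 mul1mx; apply.
apply/eqP => /rowP /(_ 0); rewrite !mxE eqxx => /eqP.
by rewrite oner_eq0.
Qed.

Lemma spd_schur n (M : 'M[R]_(1 + n)) : spd M ->
  spd (drsubmx M - (M 0 0)^-1 *: ((ursubmx M)^T *m ursubmx M)).
Proof.
move=> sM; have a0 := spd_pivot sM; split.
  rewrite linearB /= linearZ /= trmx_mul trmxK; congr (_ - _).
  by rewrite trmx_drsub (proj1 sM).
move=> y y0; rewrite -/(qform _ _).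
have a1 : M 0 0 != 0 by rewrite gt_eqF.
have := @qform_block n (M 0 0) (ursubmx M) (drsubmx M) (- (dotp y (ursubmx M) / M 0 0)) y a1.
rewrite -spd_blockE // addNr expr0n /= mulr0 add0r => <-.
apply: (proj2 sM); apply: contra y0 => /eqP /(congr1 rsubmx).
by rewrite row_mxKr linear0 => ->.
Qed.

Lemma qform_drsub n (M : 'M[R]_(1 + n)) y : qform M (row_mx 0 y) = qform (drsubmx M) y.
Proof.
rewrite -{1}[M]submxK qformE mul_row_block !mul0mx !add0r dotp_row_mx.
by rewrite dotpC dotp0l add0r.
Qed.

Lemma spd_drsub n (M : 'M[R]_(1 + n)) : spd M -> spd (drsubmx M).
Proof.
move=> [sM h]; split; first by rewrite trmx_drsub sM.
move=> y y0; rewrite -/(qform _ _).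
rewrite -qform_drsub.
apply: h; apply: contra y0 => /eqP /(congr1 rsubmx).
by rewrite row_mxKr linear0 => ->.
Qed.

End QuadraticForms.

(** * Reduction of a form by unimodular integer matrices *)

Section Reduction.
Variable R : realType.
Local Notation intmx := (map_mx (intr : int -> R)).

Lemma intvecE n (z : 'rV[int]_n) : intvec R z = intmx z.
Proof. by []. Qed.

Lemma intmx_eq0 m n (A : 'M[int]_(m, n)) : (intmx A == 0) = (A == 0).
Proof.
apply/eqP/eqP => [/matrixP h|->]; last by rewrite map_mx0.
apply/matrixP => i j; have := h i j; rewrite !mxE => /eqP.
by rewrite intr_eq0 => /eqP.
Qed.

Lemma dotp_int_ge1 n (z : 'rV[int]_n) : z != 0 -> 1 <= dotp (intmx z) (intmx z).
Proof.
move=> z0; have : dotp (intmx z) (intmx z) = ((z *m z^T) 0 0)%:~R.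
  by rewrite /dotp map_trmx -map_mxM mxE.
move=> e; have := @dotp_gt0 R n (intmx z); rewrite intmx_eq0 z0 => /(_ isT).
by rewrite e ltr0z ler1z gtz0_ge1.
Qed.

Lemma unit_intmx n (V : 'M[int]_n) : V \in unitmx -> intmx V \in unitmx.
Proof. by rewrite !unitmxE det_map_mx; exact: rmorph_unit. Qed.

Lemma row_unitmx_neq0 (K : comUnitRingType) n (V : 'M[K]_n) i :
  1 != 0 :> K -> V \in unitmx -> row i V != 0.
Proof.
move=> K1 uV; apply/eqP => /(congr1 (mulmx^~ (invmx V))).
rewrite -row_mul mulmxV // mul0mx => /rowP /(_ i); rewrite !mxE eqxx.
exact/eqP.
Qed.

Lemma near_int_half (x : R) : exists k : int, (k%:~R + x) ^+ 2 <= 1 / 4.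
Proof.
exists (- Num.floor (x + 1 / 2)); have := floor_itv (x + 1 / 2).
rewrite intrN intrD; set f := (Num.floor _)%:~R => /andP[h1 h2].
nra.
Qed.

(** The near-minimum is taken over the rows of all unimodular matrices, so the short vector comes
    with a basis containing it. Coercivity and integrality bound these values away from 0. *)
Lemma shortest_first_row n (M : 'M[R]_n.+1) : spd M ->
  exists2 V : 'M[int]_n.+1, V \in unitmx &
    forall (W : 'M[int]_n.+1) i, W \in unitmx ->
      qform M (row 0 (intmx V)) <= 2 * qform M (row i (intmx W)).
Proof.
move=> sM; have [c c0 hc] := spd_coercive sM.
pose S := [set r | exists (W : 'M[int]_n.+1) i, W \in unitmx /\ r = qform M (row i (intmx W))].
have S0 : S !=set0 by exists (qform M (row 0 (intmx 1%:M))), 1%:M, 0; rewrite unitmx1.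
have lS : lbound S c.
  move=> _ [W [i [uW ->]]]; apply: le_trans (hc _); rewrite -map_row.
  by apply: ler_peMr; [exact: ltW | apply: dotp_int_ge1; exact: row_unitmx_neq0].
have [_ [V [j [uV ->]]] h] := ex_near_min c0 S0 lS.
exists (xrow 0 j V); first by rewrite unitmxE xrowE det_mulmx unitrM -!unitmxE unitmx_perm.
move=> W i uW; rewrite map_xrow; apply: le_trans (h _ _); last by exists W, i.
by rewrite (_ : row 0 _ = row j (intmx V)) //; apply/rowP => k; rewrite !mxE tpermL.
Qed.

(** Induction on the dimension: a nearly shortest first vector, then a reduced basis of the Schur
    complement, lifted and size-reduced. The vector z originates in the final one-dimensional stage;
    each stage costs a factor 4. *)
Lemma reduced_basis n (M : 'M[R]_n.+1) : spd M ->
  exists (U : 'M[int]_n.+1) (z : 'rV[int]_n.+1), [/\ U \in unitmx, z != 0 &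
    forall i x, qform M (row i (intmx U)) * dotp x (intmx z) ^+ 2 <= 4 ^+ n * qform M x].
Proof.
elim: n M => [|n IH] M sM.
  exists 1%:M, 1%:M; split; rewrite ?unitmx1 ?oner_eq0 // => i x.
  rewrite expr0 mul1r map_mx1 row1 ord1 /qform -rowE trmx_delta -colE /dotp trmx1 mulmx1.
  by rewrite [x]mx11_scalar tr_scalar_mx mul_scalar_mx mul_mx_scalar !mxE eqxx mulr1n; lra.
have [V uV hV] := shortest_first_row sM.
pose M1 : 'M[R]_(1 + n.+1) := intmx V *m M *m (intmx V)^T.
have uVR := unit_intmx uV.
have sM1 : spd M1 by exact: spd_congr.
have aE : M1 0 0 = qform M (row 0 (intmx V)) by rewrite qform_row.
have a0 := spd_pivot sM1.
have sS := spd_schur sM1.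
set b := ursubmx M1 in sS; set S := _ - _ in sS.
have qM1 t y : qform M1 (row_mx t%:M y) = M1 0 0 * (t + dotp y b / M1 0 0) ^+ 2 + qform S y.
  by rewrite {1}[M1]spd_blockE // qform_block // gt_eqF.
have [U' [z' [uU' z'0 h']]] := IH _ sS.
(* Rounding the coefficient along the first vector makes the square in [qform_block] at most 1/4. *)
have [k hk] : exists k : 'cV[int]_n.+1, forall i,
   ((k i 0)%:~R + dotp (row i (intmx U')) b / M1 0 0) ^+ 2 <= 1 / 4.
  have [f hf] := choice (fun i => near_int_half (dotp (row i (intmx U')) b / M1 0 0)).
  by exists (\col_i f i) => i; rewrite mxE.
pose U1 : 'M[int]_(1 + n.+1) := block_mx 1%:M 0 k U'.
pose z1 : 'rV[int]_(1 + n.+1) := row_mx 0 z'.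
have uU1 : U1 \in unitmx by rewrite unitmxE det_lblock det1 mul1r -unitmxE.
pose q i := qform S (row i (intmx U')).
have r0 i : qform M1 (row (lshift _ i) (intmx U1)) = M1 0 0.
  rewrite map_block_mx block_mxEv rowKu row_row_mx map_mx1 map_mx0 row0.
  have -> : row i (1%:M : 'M[R]_1) = 1%:M by rewrite row_id.
  by rewrite qM1 /dotp /qform !mul0mx !mxE mul0r !addr0 expr1n mulr1.
have r1 i : qform M1 (row (rshift _ i) (intmx U1)) <= M1 0 0 / 4 + q i.
  rewrite map_block_mx block_mxEv rowKd row_row_mx [row i (intmx k)]mx11_scalar qM1 lerD2r.
  have -> : row i (intmx k) 0 0 = (k i 0)%:~R by rewrite !mxE.
  apply: le_trans (ler_wpM2l (ltW a0) (hk i)) _; lra.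
(* Each lifted row competes with the nearly shortest one, so a <= 2 (a / 4 + q i) with a =
   [M1 0 0]. *)
have ha i : M1 0 0 <= 4 * q i.
  have := hV (U1 *m V) (@rshift 1 n.+1 i); rewrite unitmx_mul uU1 uV => /(_ isT).
  rewrite map_mxM row_mul -qform_congr -/M1 -aE => h.
  have := r1 i; lra.
have hr i : exists j, qform M1 (row i (intmx U1)) <= 4 * q j.
  case: (split_ordP i) => j ->; first by exists 0; rewrite r0.
  by exists j; apply: le_trans (r1 j) _; have := ha j; lra.
(* The basis is multiplied by V, hence the dual vector by the inverse transpose. *)
exists (U1 *m V), (z1 *m (invmx V)^T); split.
- by rewrite unitmx_mul uU1.
- apply: contra z'0 => /eqP /(congr1 (mulmx^~ V^T)).
  rewrite -mulmxA -trmx_mul mulmxV // trmx1 mulmx1 mul0mx => /(congr1 (@rsubmx _ 1 1 n.+1)).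
  by rewrite row_mxKr linear0 => ->.
move=> i x; rewrite map_mxM row_mul -qform_congr -/M1.
pose y : 'rV[R]_(1 + n.+1) := x *m intmx (invmx V).
have -> : dotp x (intmx (z1 *m (invmx V)^T)) = dotp y (intmx z1).
  by rewrite /dotp map_trmx trmx_mul trmxK map_mxM mulmxA -map_trmx.
have -> : qform M x = qform M1 y.
  by rewrite /M1 qform_congr /y -mulmxA -map_mxM mulVmx // map_mx1 mulmx1.
have -> : dotp y (intmx z1) = dotp (rsubmx y) (intmx z').
  by rewrite -{1}[y]hsubmxK map_row_mx dotp_row_mx map_mx0 /dotp trmx0 mulmx0 mxE add0r.
have [j hj] := hr i.
have hw : qform S (rsubmx y) <= qform M1 y.
  rewrite -{2}[y]hsubmxK [lsubmx y]mx11_scalar qM1 lerDr.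
  by rewrite mulr_ge0 ?sqr_ge0 // ltW.
apply: le_trans (ler_wpM2r (sqr_ge0 _) hj) _.
have := le_trans (h' j (rsubmx y)) (ler_wpM2l (exprn_ge0 n (ler0n R 4)) hw).
by rewrite (exprS 4) -(mulrA 4) -(mulrA 4) -/(q j) => h; rewrite ler_wpM2l.
Qed.

End Reduction.

(** * Successive minima and the dual integer vector *)

Section SuccMin.
Variable R : realType.
Local Notation intmx := (map_mx (intr : int -> R)).

Lemma sqr_mnorm n (M : 'M[R]_n) u : spd M -> mnorm M u ^+ 2 = qform M u.
Proof. by move=> sM; rewrite /mnorm sqr_sqrtr //; exact: spd_ge0. Qed.

Lemma succ_min_ge0 n (M : 'M[R]_n) i : 0 <= succ_min M i.
Proof.
rewrite /succ_min; set S := [set _ | _]; have [->|/set0P S0] := eqVneq S set0.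
  by rewrite inf0.
by apply: lb_le_inf => // _ [u [_ _ [k [_ ->]]]]; exact: sqrtr_ge0.
Qed.

(** Sorting the rows of U by norm gives an admissible family for [succ_min]; the index found is that
    of the longest row. *)
Lemma succ_min_le n (M : 'M[R]_n.+1) (U : 'M[int]_n.+1) : U \in unitmx ->
  exists i, succ_min M n.+1 <= mnorm M (row i (intmx U)).
Proof.
move=> uU; pose g i := mnorm M (row i (intmx U)).
pose s := sort (fun i j => g i <= g j) (enum 'I_n.+1).
have szs : size s = n.+1 by rewrite size_sort size_enum_ord.
have us : uniq s by rewrite sort_uniq enum_uniq.
pose f (i : 'I_n.+1) := nth ord0 s i.
have fI : injective f.
  by move=> i j /eqP; rewrite nth_uniq ?szs ?ltn_ord // => /eqP /val_inj.
exists (f ord_max); apply: ge_inf.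
  by exists 0 => _ [u [_ _ [k [_ ->]]]]; exact: sqrtr_ge0.
exists (fun i => row (f i) U); split.
- rewrite row_free_unit.
  suff -> : \matrix_(j < n.+1) intvec R (row (f j) U) = row_perm (perm fI) (intmx U).
    by rewrite row_permE unitmx_mul unitmx_perm unit_intmx.
  by apply/matrixP => i j; rewrite !mxE permE.
- move=> j k jk; rewrite !intvecE !map_row -!/(g _).
  have leg_trans : transitive (fun i j => g i <= g j) by move=> x y z; exact: le_trans.
  have leg_refl : reflexive (fun i j => g i <= g j) by move=> x; exact: lexx.
  have ss : sorted (fun i j => g i <= g j) s by apply: sort_sorted => x y; exact: le_total.
  by apply: (sorted_leq_nth leg_trans leg_refl ord0 ss); rewrite // inE szs.
- by exists ord_max; split => //; rewrite intvecE map_row.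
Qed.

Lemma succ_min_transference n (M : 'M[R]_n.+1) : spd M ->
  exists2 z : 'rV[int]_n.+1, z != 0 &
    forall x, succ_min M n.+1 * `|dotp x (intmx z)| <= 2 ^+ n * mnorm M x.
Proof.
move=> sM; have [U [z [uU z0 h]]] := reduced_basis sM.
have [i hi] := succ_min_le M uU.
exists z => // x; apply: le_trans (ler_wpM2r (normr_ge0 _) hi) _.
rewrite -ler_sqr ?nnegrE ?mulr_ge0 ?exprn_ge0 ?sqrtr_ge0 //.
rewrite !exprMn !sqr_mnorm // real_normK ?num_real // -exprM mulnC exprM.
by rewrite (_ : 2 ^+ 2 = 4) // -natrX.
Qed.

(** * Orthogonal matrices and approximate diagonalization *)

Lemma orthog_dotp n (Q : 'M[R]_n) x : orthog_grp R n Q -> dotp (x *m Q) (x *m Q) = dotp x x.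
Proof.
move=> /mulmx1C QQ; rewrite /dotp trmx_mul mulmxA -(mulmxA x).
by rewrite QQ mulmx1.
Qed.

Lemma dotp_row1 n (i : 'I_n) : dotp (row i (1%:M : 'M[R]_n)) (row i 1%:M) = 1.
Proof. by rewrite -(qform1 (row i _)) qform_row trmx1 !mulmx1 mxE eqxx. Qed.

Lemma orthog_reflection n (v : 'rV[R]_n) : v != 0 ->
  orthog_grp R n (1%:M - (2 / dotp v v) *: (v^T *m v)).
Proof.
move=> /dotp_gt0; set c := 2 / _ => vv.
rewrite /orthog_grp /= [(_ - _)^T]linearB /= [(_ *: _)^T]linearZ /= trmx_mul trmxK trmx1.
rewrite mulmxBl !mulmxBr !mul1mx !mulmx1 -scalemxAl -scalemxAr.
rewrite -mulmxA (mulmxA v) mul_tr_dotp mul_scalar_mx -scalemxAr !scalerA.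
rewrite -scalerBl -addrA -opprD -scalerDl.
rewrite (_ : c + _ = 0) ?scale0r ?subr0 //.
by rewrite /c; field; rewrite gt_eqF.
Qed.

(** The reflection along [e - e0] exchanges these two unit vectors. *)
Lemma householder n (e : 'rV[R]_n.+1) : dotp e e = 1 ->
  exists2 Q : 'M[R]_n.+1, orthog_grp R n.+1 Q & row 0 Q = e.
Proof.
move=> e1; pose e0 : 'rV[R]_n.+1 := row 0 1%:M; pose v := e - e0.
have d1 : dotp (e0) (e0) = 1 :> R by exact: dotp_row1.
have [v0|v0] := eqVneq v 0.
  exists 1%:M; first by rewrite /orthog_grp /= trmx1 mulmx1.
  by apply/esym/eqP; rewrite -subr_eq0 -/v v0.
have vv := dotp_gt0 v0.
pose c := 2 / dotp v v.
exists (1%:M - c *: (v^T *m v)).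
  exact: orthog_reflection.
rewrite [row 0 _]linearB /= [row 0 (_ *: _)]linearZ /= row_mul [row 0 v^T]mx11_scalar mul_scalar_mx scalerA.
suff -> : c * row 0 v^T 0 0 = -1 by rewrite scaleN1r opprK addrC subrK.
have -> : row 0 v^T 0 0 = dotp (e0) v by rewrite /dotp -row_mul mul1mx.
have : dotp v v = 2 - 2 * dotp (e0) e.
  by rewrite {1}/v dotpBl !dotpBr e1 d1 (dotpC e); lra.
have -> : dotp (e0) v = dotp (e0) e - 1 by rewrite dotpBr d1.
move=> h; have {h} -> : dotp (e0) e - 1 = - dotp v v / 2 by lra.
by rewrite /c; field; rewrite gt_eqF.
Qed.

(** A stand-in for an eigenvector of the smallest eigenvalue: near-minimize on the unit sphere, then
    extend by homogeneity. *)
Lemma rayleigh_near_min n (M : 'M[R]_n.+1) : spd M ->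
  exists2 e, dotp e e = 1 & forall y, qform M e * dotp y y <= 2 * qform M y.
Proof.
move=> sM; have [c c0 hc] := spd_coercive sM.
pose S := [set r | exists e, dotp e e = 1 /\ r = qform M e].
have S0 : S !=set0.
  exists (qform M (row 0 1%:M)), (row 0 1%:M); split => //.
  exact: dotp_row1.
have lS : lbound S c by move=> _ [e [e1 ->]]; have := hc e; rewrite e1 mulr1.
have [_ [e [e1 ->]] h] := ex_near_min c0 S0 lS.
exists e => // y; have [->|y0] := eqVneq y 0.
  by rewrite dotp0l qform0 !mulr0.
have yy := dotp_gt0 y0; have ss : Num.sqrt (dotp y y) ^+ 2 = dotp y y by rewrite sqr_sqrtr // ltW.
have s0 : 0 < Num.sqrt (dotp y y) by rewrite sqrtr_gt0.
rewrite -ler_pdivlMr //; apply: le_trans (h (qform M ((Num.sqrt (dotp y y))^-1 *: y)) _) _.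
  exists ((Num.sqrt (dotp y y))^-1 *: y); split => //.
  by rewrite dotpZl dotpZr mulrA -expr2 exprVn ss mulVf // gt_eqF.
rewrite qformE -scalemxAl dotpZl dotpZr -qformE (mulrA _^-1) -expr2 exprVn ss.
by rewrite le_eqVlt; apply/orP; left; apply/eqP; field; rewrite gt_eqF.
Qed.

Lemma det_orthog_congr n (Q M : 'M[R]_n) : orthog_grp R n Q -> \det (Q *m M *m Q^T) = \det M.
Proof.
move=> QQ; rewrite !det_mulmx mulrAC -det_mulmx (mulmx1C QQ) det1 mul1r //.
Qed.

Lemma orthog_unit n (Q : 'M[R]_n) : orthog_grp R n Q -> Q \in unitmx.
Proof. by move=> /mulmx1_unit []. Qed.

(** Rotate a near-minimizer of the Rayleigh quotient to the first axis and treat the remaining block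
    D by induction. The determinant is [s * \det D], with s the Schur complement of D, so it
    suffices that a <= 2 s at each stage. *)
Lemma near_diagonalization n (M : 'M[R]_n) : spd M ->
  exists2 Q, orthog_grp R n Q & \prod_i qform M (row i Q) <= 2 ^+ n * \det M.
Proof.
elim: n M => [|n IH] M sM.
  by exists 1%:M; rewrite ?big_ord0 ?det_mx00 ?mulr1 // /orthog_grp /= trmx1 mulmx1.
have [e e1 he] := rayleigh_near_min sM.
have [Q1 oQ1 re] := householder e1.
pose M1 : 'M[R]_(1 + n) := Q1 *m M *m Q1^T.
have sM1 : spd M1 by apply: spd_congr => //; exact: orthog_unit.
have aE : M1 0 0 = qform M e by rewrite -re qform_row.
set a := M1 0 0 in aE.
have ha (y : 'rV[R]_(1 + n)) : a * dotp y y <= 2 * qform M1 y.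
  by rewrite qform_congr -(orthog_dotp y oQ1) aE.
have a0 : 0 < a := spd_pivot sM1.
set D := drsubmx M1; set b := ursubmx M1.
have sD : spd D := spd_drsub sM1.
have uD := spd_unitmx sD.
(* The row (1, w) times [M1] is (s, 0), so the form takes the value s there. *)
pose w := - (b *m invmx D).
pose s := a + dotp w b.
have wD : b + w *m D = 0 by rewrite /w mulNmx mulmxKV // subrr.
have ME : M1 = block_mx a%:M b b^T D := spd_blockE sM1.
have dM : \det M1 = s * \det D.
  have : \det (block_mx 1%:M w 0 1%:M *m M1) = s * \det D.
    rewrite {1}ME mulmx_block !mul1mx !mul0mx !add0r wD.
    by rewrite det_lblock mul_tr_dotp -raddfD /= det_scalar expr1.
  by rewrite det_mulmx det_ublock !det1 !mul1r.
have ws : qform M1 (row_mx 1%:M w) = s.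
  rewrite {1}ME qformE mul_row_block !mul1mx wD.
  by rewrite mul_tr_dotp -raddfD /= dotp_row_mx dotp_scalar mulr1 dotp0l addr0.
(* (1, w) has length at least 1, and a is nearly minimal on the unit sphere. *)
have as2 : a <= 2 * s.
  rewrite -ws; apply: le_trans (ha _).
  rewrite dotp_row_mx dotp_scalar mulr1.
  by apply: ler_peMr; [exact: ltW | rewrite lerDl dotp_ge0].
have [Q' oQ' h'] := IH _ sD.
pose B : 'M[R]_(1 + n) := block_mx 1%:M 0 0 Q'.
have oB : B^T *m B = 1%:M.
  rewrite /B tr_block_mx mulmx_block !trmx0 trmx1 !mulmx1 !mulmx0 !mul0mx !addr0 !add0r.
  by rewrite oQ' -scalar_mx_block.
exists (B *m (Q1 : 'M[R]_(1 + n))).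
  by rewrite /orthog_grp /= trmx_mul mulmxA -(mulmxA Q1^T) oB mulmx1.
rewrite -(det_orthog_congr M oQ1) -/M1 dM.
have qB (i : 'I_(1 + n)) : qform M (row i (B *m (Q1 : 'M[R]_(1 + n)))) = qform M1 (row i B).
  by rewrite row_mul -qform_congr.
under eq_bigr do rewrite qB.
rewrite (@big_split_ord _ _ _ 1 n) /= big_ord1.
have -> : qform M1 (row (lshift n ord0) B) = a.
  rewrite /B block_mxEv rowKu row_row_mx row0 row_id ME qform_block ?gt_eqF //.
  by rewrite dotp0l qform0 mul0r !addr0 expr1n mulr1.
under eq_bigr do rewrite /B block_mxEv rowKd row_row_mx row0 qform_drsub.
(* The sign is read off [h'], since [spd_det_gt0] is itself deduced from this lemma. *)
have dD : 0 <= \det D.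
  rewrite -(pmulr_rge0 _ (exprn_gt0 n (ltr0n R 2))); apply: le_trans h'.
  by apply: prodr_ge0 => i _; exact: spd_ge0.
apply: le_trans (ler_wpM2l (ltW a0) h') _.
rewrite (_ : 2 ^+ n.+1 * (s * \det D) = (2 * s) * (2 ^+ n * \det D)); last by rewrite exprS; ring.
by rewrite ler_wpM2r // mulr_ge0 // exprn_ge0.
Qed.

Lemma spd_orthog_gt0 n (M Q : 'M[R]_n) i : spd M -> orthog_grp R n Q ->
  0 < qform M (row i Q).
Proof.
move=> sM /orthog_unit uQ; apply: (proj2 sM).
by apply: row_unitmx_neq0 => //; exact: oner_neq0.
Qed.

Lemma spd_det_gt0 n (M : 'M[R]_n) : spd M -> 0 < \det M.
Proof.
move=> sM; have [Q oQ h] := near_diagonalization sM.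
rewrite -(pmulr_rgt0 _ (exprn_gt0 n (ltr0n R 2))); apply: lt_le_trans h.
by apply: prodr_gt0 => i _; exact: spd_orthog_gt0.
Qed.

End SuccMin.

(** * Plane rotations of slabs *)

Section Packing.
Variable R : realType.

Lemma dotp_delta n (k l : 'I_n) : dotp (row k 1%:M) (row l (1%:M : 'M[R]_n)) = (k == l)%:R.
Proof. by rewrite /dotp -row_mul mul1mx !mxE eq_sym. Qed.

Definition givens n (i j : 'I_n) (p q : R) : 'M[R]_n :=
  \matrix_k (if k == i then p *: row i 1%:M + q *: row j 1%:M
             else if k == j then p *: row j 1%:M + (- q) *: row i 1%:M
             else row k 1%:M).

Lemma givens_orthog n (i j : 'I_n) (p q : R) :
  i != j -> p ^+ 2 + q ^+ 2 = 1 -> orthog_grp R n (givens i j p q).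
Proof.
move=> ij pq; rewrite /orthog_grp /=; apply: mulmx1C; apply/matrixP => k l.
have -> : (givens i j p q *m (givens i j p q)^T) k l =
          dotp (row k (givens i j p q)) (row l (givens i j p q)).
  by rewrite /dotp tr_row -row_mul !mxE; apply: eq_bigr => m _; rewrite !mxE.
have ji := negbTE ij; have ij' : (j == i) = false by rewrite eq_sym.
rewrite !rowK mxE.
have dDr (x y z : 'rV[R]_n) : dotp z (x + y) = dotp z x + dotp z y.
  by rewrite dotpC dotpDl !(dotpC z).
case: (eqVneq k i) => [?|ki]; [subst k|case: (eqVneq k j) => [?|kj]; [subst k|]];
  (case: (eqVneq l i) => [?|li]; [subst l|case: (eqVneq l j) => [?|lj]; [subst l|]]);
  rewrite ?(dotpDl, dotpZl) ?(dDr, dotpZr) ?dotp_delta ?eqxx ?ji ?ij' ?(negbTE ki) ?(negbTE kj)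
    ?(eq_sym _ l) ?(negbTE li) ?(negbTE lj) ?(mulr0, mulr1, addr0, add0r) //.
- by rewrite mulr0n; ring.
- by rewrite mulr0n; ring.
- by rewrite mulr1n -pq; ring.
Qed.

(** The rotated coordinates are (a - t b) / r and (b + t a) / r. From b + t a = r^2 b + t (a - t b)
    follows c - t e <= r |b|; then e <= c / 4 and r <= 3 / 2 give the bound. *)
Lemma rotated_slab_bound (t r e c a b : R) : 0 <= t -> t <= 1 -> 1 <= r ->
  r ^+ 2 = 1 + t ^+ 2 -> 0 < e -> 4 * e <= c -> `|a - t * b| <= e * r ->
  c * r <= `|b + t * a| -> c / 2 <= `|b|.
Proof.
move=> t0 t1 r1 r2 e0 ec h1 h2.
have r32 : r <= 3 / 2 by nra.
have : `|b + t * a| <= r ^+ 2 * `|b| + t * `|a - t * b|.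
  have -> : b + t * a = r ^+ 2 * b + t * (a - t * b) by rewrite r2; ring.
  by apply: le_trans (ler_normD _ _) _; rewrite !normrM (ger0_norm t0) -expr2 real_normK ?num_real.
have := normr_ge0 b; move: `|b| `|a - _| h1 `|_| h2 => B A hA S hS B0 hh.
have h3 : r * (c - t * e) <= r * (r * B) by nra.
have r0 : 0 < r by lra.
rewrite ler_pM2l // in h3.
nra.
Qed.

(** (t - t') b is a difference of two terms of total size at most 3 e, and |b| >= c / 2, so |t - t'|
    <= 6 e / c. *)
Lemma rotated_slabs_apart (t t' r r' e c a b : R) : r <= 3 / 2 -> r' <= 3 / 2 ->
  0 < e -> 0 < c -> c / 2 <= `|b| -> `|a - t * b| <= e * r -> `|a - t' * b| <= e * r' ->
  `|t - t'| < 8 * e / c.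
Proof.
move=> hr hr' e0 c0 hb h1 h2.
have : `|t - t'| * `|b| <= `|a - t * b| + `|a - t' * b|.
  rewrite -normrM (_ : (t - t') * b = (a - t' * b) - (a - t * b)); last by ring.
  by rewrite [leRHS]addrC; exact: ler_normB.
rewrite ltr_pdivlMr //; move: `|b| `|t - t'| (normr_ge0 (t - t')) hb => B D D0 hb hD.
have h3 : `|a - t * b| + `|a - t' * b| <= 3 * e by nra.
have h4 : D * (c / 2) <= D * B by rewrite ler_wpM2l.
lra.
Qed.

Lemma continuous_dotp_row n (i : 'I_n) (z : 'rV[R]_n) :
  continuous (fun X : 'M[R]_n => dotp (row i X) z).
Proof.
under eq_fun do rewrite dotpE.
apply: continuous_big => [|k _ X]; first exact: add_continuous.
have -> : (fun X : 'M[R]_n => row i X 0 k * z 0 k) = (fun X => X i k * z 0 k).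
  by apply/funext => Y; rewrite mxE.
by apply: continuousM; [exact: (@coord_continuous R n n i k X) | exact: cst_continuous].
Qed.

Lemma continuous_dotp_mul n (u z : 'rV[R]_n) :
  continuous (fun X : 'M[R]_n => dotp (u *m X) z).
Proof.
have -> : (fun X : 'M[R]_n => dotp (u *m X) z) = (fun X => \sum_k u 0 k * dotp (row k X) z).
  apply/funext => X; rewrite /dotp -mulmxA mxE; apply: eq_bigr => k _.
  by rewrite -row_mul [in RHS]mxE.
apply: continuous_big => [|k _ X]; first exact: add_continuous.
apply: (continuousM (s := fun=> u 0 k) (t := fun X : 'M[R]_n => dotp (row k X) z)).
  exact: cst_continuous.
exact: continuous_dotp_row.
Qed.

Lemma closed_measurable n (A : set 'M[R]_n) : closed A -> measurable (A : set (borelM R n)).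
Proof.
move=> cA; rewrite -[A]setCK; apply: measurableC; apply: sub_sigma_algebra.
by rewrite openC.
Qed.


(** * Haar measure of slabs *)

Section HaarSlabs.
Variables (n : nat) (mu : {measure set (borelM R n) -> \bar R}) (z : 'rV[R]_n).
Hypothesis mu1 : mu setT = 1%E.
Hypothesis muL : forall Q : 'M[R]_n, orthog_grp R n Q ->
  forall A : set (borelM R n), measurable A ->
    mu ((fun X : 'M[R]_n => Q *m X) @^-1` A) = mu A.

Definition slab (I : seq 'I_n) (eps : 'I_n -> R) (j : 'I_n) (c : R) : set (borelM R n) :=
  [set X : 'M[R]_n | (forall i, i \in I -> `|dotp (row i X) z| <= eps i) /\
                     c <= `|dotp (row j X) z| ].

Lemma measurable_preimage_slab (Q : 'M[R]_n) I eps j c :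
  measurable ((fun X : 'M[R]_n => Q *m X) @^-1` slab I eps j c : set (borelM R n)).
Proof.
apply: closed_measurable; pose f i (X : 'M[R]_n) := `|dotp (row i (Q *m X)) z|.
have cf i : continuous (f i).
  rewrite /f; under eq_fun do rewrite row_mul.
  move=> X; exact: (continuous_comp (@continuous_dotp_mul n (row i Q) z X) (@norm_continuous _ R^o _)).
have -> : (fun X : 'M[R]_n => Q *m X) @^-1` slab I eps j c =
    (\bigcap_(i in [set i | i \in I]) (f i @^-1` [set x | x <= eps i])) `&`
    (f j @^-1` [set x | c <= x]) by [].
apply: closedI; last by apply: preimage_closed; [move=> X _; exact: cf | exact: closed_ge].
by apply: closed_bigI => i _; apply: preimage_closed; [move=> X _; exact: cf | exact: closed_le].
Qed.

Lemma measurable_slab I eps j c : measurable (slab I eps j c).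
Proof.
have := measurable_preimage_slab 1%:M I eps j c.
by under eq_fun do rewrite mul1mx.
Qed.

Lemma dotp_row_givens (i j k : 'I_n) (p q : R) (X : 'M[R]_n) :
  dotp (row k (givens i j p q *m X)) z =
  if k == i then p * dotp (row i X) z + q * dotp (row j X) z
  else if k == j then p * dotp (row j X) z - q * dotp (row i X) z
  else dotp (row k X) z.
Proof.
rewrite row_mul rowK.
have h (l : 'I_n) : dotp (row l 1%:M *m X) z = dotp (row l X) z by rewrite -row_mul mul1mx.
case: ifP => _; [|case: ifP => _]; rewrite ?mulmxDl -?scalemxAl ?dotpDl ?dotpZl ?h //.
by rewrite mulNr.
Qed.

(* The copies of the thin slab rotated in the plane (i, j) by the slopes t_k = 8 k eps_i / c
   are disjoint and do not change the coordinates in I, so about c / (8 eps_i) of them fit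
   inside the slab where coordinate i is unconstrained. *)
Lemma slab_cons I eps i j c : i != j -> i \notin I -> j \notin I -> 0 < eps i -> 0 < c ->
  (mu (slab (i :: I) eps j c) <= (8 * eps i / c)%:E * mu (slab I eps j (c / 2)))%E.
Proof.
move=> ij iI jI e0 c0.
have q0 : 0 < 8 * eps i / c by rewrite divr_gt0 // mulr_gt0.
(* If c < 4 eps_i, the factor exceeds 2 and monotonicity suffices. *)
have [ec|ce] := leP (4 * eps i) c; last first.
  have h : (mu (slab (i :: I) eps j c) <= mu (slab I eps j (c / 2)))%E.
    apply: le_measure; rewrite ?inE; [exact: measurable_slab..|].
    move=> X [h1 h2]; split=> [k kI|]; first by apply: h1; rewrite inE kI orbT.
    by apply: le_trans h2; lra.
  apply: (le_trans h); rewrite -[leLHS]mul1e lee_wpmul2r // lee_fin.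
  by rewrite ler_pdivlMr //; lra.
set A := slab (i :: I) eps j c; set B := slab I eps j (c / 2).
pose K := (Num.truncn (c / (8 * eps i))).+1.
pose t (k : 'I_K) : R := k%:R * (8 * eps i / c).
pose r k := Num.sqrt (1 + t k ^+ 2).
have t0 k : 0 <= t k by rewrite mulr_ge0 // ltW.
have t1 k : t k <= 1.
  have h : (k%:R : R) <= c / (8 * eps i).
    rewrite -truncn_ge_nat; last by rewrite divr_ge0 ?mulr_ge0 // ltW.
    by rewrite -ltnS ltn_ord.
  apply: le_trans (ler_wpM2r (ltW q0) h) _; rewrite le_eqVlt; apply/orP; left; apply/eqP.
  by field; rewrite !gt_eqF.
have r2 k : r k ^+ 2 = 1 + t k ^+ 2 by rewrite sqr_sqrtr // addr_ge0 // sqr_ge0.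
have r1 k : 1 <= r k.
  by rewrite -ler_sqr ?nnegrE ?sqrtr_ge0 // r2 expr1n lerDl sqr_ge0.
have r0 k : 0 < r k by apply: lt_le_trans (r1 k).
have r32 k : r k <= 3 / 2.
  by have := r2 k; have := r1 k; have := t0 k; have := t1 k; nra.
pose G k := givens i j (r k)^-1 (- (t k / r k)).
have oG k : orthog_grp R n (G k).
  apply: givens_orthog => //; rewrite sqrrN expr_div_n exprVn -{1}[_^-1]mul1r -mulrDl -r2.
  by rewrite mulfV // expf_neq0 // gt_eqF.
pose P k : set (borelM R n) := (fun X : 'M[R]_n => G k *m X) @^-1` A.
have mP k : measurable (P k).
  exact: measurable_preimage_slab.
have PE k (X : 'M[R]_n) : P k X -> [/\ forall l, l \in I -> `|dotp (row l X) z| <= eps l,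
    `|dotp (row i X) z - t k * dotp (row j X) z| <= eps i * r k &
    c * r k <= `|dotp (row j X) z + t k * dotp (row i X) z| ].
  move=> [h1 h2]; split=> [l lI||].
  - have := h1 l; rewrite inE lI orbT => /(_ isT); rewrite dotp_row_givens.
    by rewrite (negbTE (memPn iI _ lI)) (negbTE (memPn jI _ lI)).
  - have := h1 i; rewrite inE eqxx => /(_ isT); rewrite dotp_row_givens eqxx.
    rewrite -ler_pdivrMr // -{3}(ger0_norm (ltW (r0 k))) -normf_div.
    by congr (`|_| <= _); field; rewrite gt_eqF.
  - move: h2; rewrite dotp_row_givens eq_sym (negbTE ij) eqxx.
    rewrite -ler_pdivlMr // -{3}(ger0_norm (ltW (r0 k))) -normf_div.
    by congr (_ <= `|_|); field; rewrite gt_eqF.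
have Pb k X : P k X -> c / 2 <= `|dotp (row j X) z|.
  by move=> /PE [_ h1 h2]; exact: (rotated_slab_bound (t0 k) (t1 k) (r1 k) (r2 k) e0 ec h1 h2).
have PB k : P k `<=` B.
  by move=> X PX; split; [have [] := PE _ _ PX | exact: Pb PX].
(* Distinct indices have slopes at least 8 eps_i / c apart, contradicting [rotated_slabs_apart]. *)
have tP : trivIset setT P.
  apply/trivIsetP => k l _ _ kl; apply/seteqP; split => // X [PX PY].
  have [_ h1 _] := PE _ _ PX; have [_ h2 _] := PE _ _ PY.
  have := rotated_slabs_apart (r32 k) (r32 l) e0 c0 (Pb _ _ PX) h1 h2.
  rewrite -mulrBl normrM (ger0_norm (ltW q0)) gtr_pMl //; apply/negP; rewrite -leNgt.
  move: kl; rewrite -(inj_eq val_inj) /=; case: ltngtP => // lt _.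
  - by rewrite distrC -natrB ?(ltnW lt) // ger0_norm // ler1n subn_gt0.
  - by rewrite -natrB ?(ltnW lt) // ger0_norm // ler1n subn_gt0.
have hK : (K%:R%:E * mu A <= mu B)%E.
  have -> : (K%:R%:E * mu A)%E = mu (\big[setU/set0]_(k < K) P k).
    rewrite measure_bigsetU_ord //.
    rewrite (eq_bigr (fun=> mu A)) => [|k _]; last exact: (muL (oG k) (measurable_slab _ _ _ _)).
    by rewrite sumr_const card_ord mule_natl.
  apply: le_measure; rewrite ?inE; [by apply: bigsetU_measurable|exact: measurable_slab|].
  by rewrite -bigcup_mkord_ord => X [k _ PX]; exact: PB PX.
have K0 : 0 < K%:R :> R by rewrite ltr0n.
have : (mu A <= K%:R^-1%:E * mu B)%E by rewrite lee_pdivlMl.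
move=> /le_trans; apply; rewrite lee_wpmul2r // lee_fin.
rewrite -[leRHS]invrK lef_pV2 ?posrE ?invr_gt0 // invf_div.
by apply: ltW; rewrite /K truncnS_gt.
Qed.

(** Each use of [slab_cons] halves c; [2 ^+ size I] absorbs all the halvings, and the last slab has
    measure at most 1. *)
Lemma slab_le I eps j c : uniq I -> j \notin I -> (forall i, 0 < eps i) -> 0 < c ->
  (mu (slab I eps j c) <= (\prod_(i <- I) (8 * 2 ^+ size I * eps i / c))%:E)%E.
Proof.
elim: I c => [|i I IH] c uI jI e0 c0.
  rewrite big_nil -mu1; apply: le_measure; rewrite ?inE //; exact: measurable_slab.
move: uI jI; rewrite /= inE negb_or => /andP[iI uI] /andP[ji jI].
apply: le_trans (slab_cons _ iI jI (e0 i) c0) _; first by rewrite eq_sym.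
apply: le_trans (lee_wpmul2l _ (IH (c / 2) uI jI e0 _)) _; rewrite ?divr_gt0 //.
  by rewrite lee_fin divr_ge0 ?mulr_ge0 // ltW.
rewrite -EFinM lee_fin big_cons; apply: ler_pM.
- by rewrite divr_ge0 ?mulr_ge0 // ltW.
- by apply: prodr_ge0 => k _; rewrite divr_ge0 ?mulr_ge0 ?exprn_ge0 ?divr_ge0 // ltW.
- rewrite ler_pM2r ?invr_gt0 // ler_pM2r // ler_peMr //.
  by rewrite exprn_ege1 // ler1n.
- rewrite le_eqVlt; apply/orP; left; apply/eqP; apply: eq_bigr => k _.
  by rewrite exprS; field; rewrite gt_eqF.
Qed.

End HaarSlabs.
End Packing.

(** * Covering the tail event by slabs *)

Section Tail.
Variable R : realType.
Local Notation intmx := (map_mx (intr : int -> R)).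

Lemma sum_pow2_le (L : nat) (Y : R) : 0 <= Y -> \sum_(l < L | 2 ^+ l <= Y) 2 ^+ l <= 2 * Y.
Proof.
move=> Y0; elim: L => [|L IH]; first by rewrite big_ord0 mulr_ge0.
rewrite big_mkcond big_ord_recr /= -big_mkcond /=.
case: ifP => [hL|_]; last by rewrite addr0.
have geo : \sum_(l < L) 2 ^+ l <= 2 ^+ L :> R.
  elim: L {IH hL} => [|L IH]; first by rewrite big_ord0.
  by rewrite big_ord_recr /= exprS; lra.
suff : \sum_(l < L | 2 ^+ l <= Y) 2 ^+ l <= \sum_(l < L) 2 ^+ l :> R by lra.
by rewrite big_mkcond; apply: ler_sum => l _; case: ifP => // _; rewrite exprn_ge0.
Qed.

Lemma le_mu_bigsetU d (T : measurableType d) (mu : {measure set T -> \bar R}) (I : Type)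
  (r : seq I) (P : pred I) (F : I -> set T) (b : I -> R) :
  (forall i, P i -> measurable (F i)) -> (forall i, P i -> (mu (F i) <= (b i)%:E)%E) ->
  (mu (\big[setU/set0]_(i <- r | P i) F i) <= (\sum_(i <- r | P i) b i)%:E)%E.
Proof.
move=> mF hb; elim: r => [|i r IH]; first by rewrite !big_nil measure0.
rewrite !big_cons; case: ifP => // Pi; rewrite EFinD.
apply: le_trans (leeD (hb i Pi) IH).
by apply: measureU2; [exact: mF | exact: bigsetU_measurable].
Qed.

Lemma sub_bigsetU (I : finType) T (P : pred I) (F : I -> set T) i : P i ->
  F i `<=` \big[setU/set0]_(i | P i) F i.
Proof.
move=> Pi x Fx; rewrite -bigcup_seq_cond; exists i => //=.
by rewrite mem_index_enum.
Qed.

(** Otherwise each squared coordinate is below (c / d)^2 <= c^2 / d, so |z|^2 < c^2 as Y preserves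
    length; but z has an entry of size at least c. *)
Lemma orthog_coord_large n (Y : 'M[R]_n.+1) (z : 'rV[R]_n.+1) (c : R) : orthog_grp R n.+1 Y ->
  0 <= c -> (exists i, c <= `|z 0 i|) -> exists j, c / n.+1%:R <= `|dotp (row j Y) z|.
Proof.
move=> oY c0 [i hi]; apply: contrapT => /forallNP h.
have d1 : 1 <= n.+1%:R :> R by rewrite ler1n.
set d := n.+1%:R in h d1.
have {}h j : dotp (row j Y) z ^+ 2 < c ^+ 2 / d.
  have h2 : `|dotp (row j Y) z| < c / d by rewrite ltNge; apply/negP; exact: h.
  rewrite -real_normK ?num_real //; apply: (@lt_le_trans _ _ ((c / d) ^+ 2)).
    by rewrite ltr_sqr ?nnegrE // divr_ge0 //; lra.
  have d0 : 0 < d by lra.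
  by rewrite expr_div_n ler_wpM2l ?sqr_ge0 // lef_pV2 ?posrE ?exprn_gt0 // expr2 ler_peMr // ltW.
have zz : dotp z z = \sum_j dotp (row j Y) z ^+ 2.
  have oYT : orthog_grp R n.+1 Y^T by rewrite /orthog_grp /= trmxK; exact: mulmx1C.
  rewrite -(orthog_dotp z oYT) dotpE; apply: eq_bigr => j _; rewrite -expr2; congr (_ ^+ 2).
  by rewrite dotpC dotpE mxE; apply: eq_bigr => k _; rewrite !mxE.
have : c ^+ 2 <= dotp z z.
  rewrite dotpE (bigD1 i) //= -expr2.
  have h1 : c ^+ 2 <= z 0 i ^+ 2 by rewrite -[leRHS]real_normK ?num_real // ler_sqr ?nnegrE.
  by apply: le_trans h1 _; rewrite lerDl sumr_ge0 // => k _; rewrite -expr2 sqr_ge0.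
have : dotp z z < c ^+ 2.
  have -> : c ^+ 2 = \sum_(j < n.+1) c ^+ 2 / d.
    by rewrite sumr_const card_ord -mulr_natr divfK // gt_eqF //; lra.
  by rewrite zz; apply: ltr_sum => //; apply/hasP; exists ord0; rewrite ?mem_index_enum.
by move=> h1 /(lt_le_trans h1); rewrite ltxx.
Qed.

Lemma int_row_shell n (z : 'rV[int]_n.+1) : z != 0 ->
  exists l, (exists i, (2 ^ l <= `|z 0%R i|)%N) /\ forall i, (`|z 0%R i| < 2 ^ l.+1)%N.
Proof.
move=> z0; pose m := (\max_i `|z 0%R i|)%N.
have [i hi] : exists i, m = `|z 0%R i|%N.
  have I0 : (0 < #|'I_n.+1|)%N by rewrite card_ord.
  by have [i h] := bigop.eq_bigmax (fun i => `|z 0%R i|%N) I0; exists i.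
have hm k : (`|z 0%R k| <= m)%N by exact: bigop.leq_bigmax.
have m0 : (0 < m)%N.
  rewrite lt0n; apply: contra z0 => /eqP m0; apply/eqP/rowP => k; rewrite mxE.
  by have := hm k; rewrite m0 leqn0 absz_eq0 => /eqP.
exists (trunc_log 2 m); split; first by exists i; rewrite -hi trunc_logP.
by move=> k; apply: leq_ltn_trans (hm k) _; exact: trunc_log_ltn.
Qed.

(** Indexes the integer vectors with entries in [-2^(l+1), 2^(l+1)) by a finite type, so that they
    can be counted and unions over them are finite. *)
Definition box_point n l (f : {ffun 'I_n -> 'I_(2 ^ l.+2)}) : 'rV[int]_n :=
  \row_i ((f i)%:Z - (2 ^ l.+1)%:Z).

Lemma box_point_surj n l (z : 'rV[int]_n) : (forall i, `|z 0%R i| < 2 ^ l.+1)%N ->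
  exists f : {ffun 'I_n -> 'I_(2 ^ l.+2)}, z = box_point f.
Proof.
move=> h.
have hz i : exists k : 'I_(2 ^ l.+2), z 0 i = k%:Z - (2 ^ l.+1)%:Z.
  have := h i; set a := z 0 i; set N := (2 ^ l.+1)%N => ha.
  have hlt : (absz (a + N%:Z)%R < 2 ^ l.+2)%N by rewrite expnS -/N; lia.
  by exists (Ordinal hlt) => /=; lia.
have [f hf] := choice hz.
by exists [ffun i => f i]; apply/rowP => i; rewrite mxE ffunE -hf.
Qed.

(** Transference for X^T M X is tested on the rows of Q X; as X X^T = 1, their norms are those of
    the rows of Q for M. *)
Lemma succ_min_orthog_dual n (M Q X : 'M[R]_n.+1) T : spd M -> orthog_grp R n.+1 X -> 0 < T ->
  T < succ_min (X^T *m M *m X) n.+1 ->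
  exists2 z : 'rV[int]_n.+1, z != 0 &
    forall i, `|dotp (row i (Q *m X)) (intmx z)| <= 2 ^+ n / T * Num.sqrt (qform M (row i Q)).
Proof.
move=> sM oX T0 hT.
have sN : spd (X^T *m M *m X).
  rewrite -{2}[X]trmxK; apply: spd_congr => //; rewrite unitmx_tr; exact: orthog_unit.
have [z z0 hz] := succ_min_transference sN.
exists z => // i; have := hz (row i (Q *m X)).
have -> : mnorm (X^T *m M *m X) (row i (Q *m X)) = Num.sqrt (qform M (row i Q)).
  rewrite /mnorm; congr Num.sqrt; rewrite -/(qform _ _) -{2}[X]trmxK qform_congr row_mul.
  by rewrite -mulmxA (mulmx1C oX) mulmx1.
move=> h; rewrite mulrAC ler_pdivlMr // mulrC; apply: le_trans h.
by rewrite ler_wpM2r // ltW.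
Qed.

(** With d = n + 1, the factors come in order from the number of box points, [slab_le] with c = 2^l
    / d, the sum over l and the sum over j. *)
Definition tail_const (n : nat) : R :=
  4 ^+ n.+1 * (8 * 2 ^+ n * n.+1%:R) ^+ n * (2 * n.+1%:R) * n.+1%:R.

(** Union bound over the scale l, the box points and the large coordinate j. The set W is measurable
    and covers the event for all z at once. *)
Lemma lattice_slabs_le n (mu : {measure set (borelM R n.+1) -> \bar R}) (Q : 'M[R]_n.+1)
  (e : 'I_n.+1 -> R) : haar_prob mu -> orthog_grp R n.+1 Q -> (forall i, 0 < e i) ->
  exists2 W : set (borelM R n.+1), measurable W /\ (mu W <= (tail_const n * \prod_i e i)%:E)%E &
    forall (X : 'M[R]_n.+1) (z : 'rV[int]_n.+1), orthog_grp R n.+1 X -> z != 0 ->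
      (forall i, `|dotp (row i (Q *m X)) (intmx z)| <= e i) -> W X.
Proof.
move=> [mu1 _ muL] oQ e0.
set d : R := n.+1%:R; have d0 : 0 < d by rewrite ltr0n.
(* Relevant scales satisfy l < 2^l <= d e_j, hence l < L. *)
pose L := (Num.truncn (d * \sum_i e i)).+1.
pose c l : R := 2 ^+ l / d.
have c0 l : 0 < c l by rewrite divr_gt0 // exprn_gt0.
pose I (j : 'I_n.+1) := [seq i <- index_enum 'I_n.+1 | i != j].
pose V l (f : {ffun 'I_n.+1 -> 'I_(2 ^ l.+2)}) j : set (borelM R n.+1) :=
  (fun X : 'M[R]_n.+1 => Q *m X) @^-1` slab (intmx (box_point f)) (I j) e j (c l).
have mV l f j : measurable (@V l f j) by exact: measurable_preimage_slab.
pose W : set (borelM R n.+1) := \big[setU/set0]_(l < L)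
  \big[setU/set0]_(f : {ffun 'I_n.+1 -> 'I_(2 ^ l.+2)})
  \big[setU/set0]_(j < n.+1 | 2 ^+ l <= d * e j) @V l f j.
pose kap : R := 8 * 2 ^+ n * d.
have sI j : size (I j) = n.
  by rewrite -sum1_size big_filter sum1_card cardC1 card_ord.
(* Invariance removes Q, and [slab_le] applies with the n thin coordinates i != j. *)
have hV l f j : (mu (@V l f j) <= (kap ^+ n / 2 ^+ (l * n) * \prod_(i | i != j) e i)%:E)%E.
  rewrite muL //; last exact: measurable_slab.
  have uI : uniq (I j) by rewrite filter_uniq // index_enum_uniq.
  have jI : j \notin I j by rewrite mem_filter eqxx.

  have h := @slab_le R n.+1 mu (intmx (box_point f)) mu1 muL (I j) e j (c l) uI jI e0 (c0 l).
  apply: (le_trans h).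
  rewrite lee_fin sI big_filter le_eqVlt; apply/orP; left; apply/eqP.
  rewrite (eq_bigr (fun i => kap / 2 ^+ l * e i)) => [|i _]; last first.
    by rewrite /kap /c; field; rewrite gt_eqF // gt_eqF // exprn_gt0.
  rewrite big_split /= prodr_const; congr (_ * _).
  by rewrite cardC1 card_ord /= expr_div_n -exprM.
exists W; first split.
- by do 3 (apply: bigsetU_measurable => ? _); exact: mV.
(* The 4^(n+1) 2^(l(n+1)) box points against 2^(-ln) leave one factor 2^l. *)
- pose b l j := 4 ^+ n.+1 * kap ^+ n * 2 ^+ l * \prod_(i | i != j) e i.
  apply: (@le_trans _ _ (\sum_(l < L) \sum_(j < n.+1 | 2 ^+ l <= d * e j) b l j)%:E).
    apply: le_mu_bigsetU => l _.
      by do 2 (apply: bigsetU_measurable => ? _); exact: mV.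
    apply: le_trans (le_mu_bigsetU (b := fun=> \sum_(j < n.+1 | 2 ^+ l <= d * e j) (kap ^+ n / 2 ^+ (l * n) * \prod_(i | i != j) e i)) _ _ _) _.
    + by move=> f _; apply: bigsetU_measurable => ? _; exact: mV.
    + by move=> f _; apply: le_mu_bigsetU.
    rewrite lee_fin sumr_const card_ffun !card_ord -[leLHS]mulr_natl mulr_sumr.
    apply: ler_sum => j _; rewrite /b mulrA le_eqVlt; apply/orP; left; apply/eqP; congr (_ * _).
    have -> : ((2 ^ l.+2) ^ n.+1)%:R = 4 ^+ n.+1 * (2 ^+ (l * n) * 2 ^+ l) :> R.
      by rewrite -[l.+2]add2n expnD expnMn natrM !natrX -[in RHS]exprD -mulnSr exprM -natrX.
    by field; rewrite expf_neq0.
  rewrite lee_fin.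
  (* Summing over l first, [sum_pow2_le] with Y = d e_j supplies the factor e_j missing from the
     product. *)
  rewrite (exchange_big_dep predT) //=.
  apply: (@le_trans _ _ (\sum_(j < n.+1) 4 ^+ n.+1 * kap ^+ n * (2 * d) * \prod_i e i)).
    apply: ler_sum => j _; rewrite /b -mulr_suml -mulr_sumr (bigD1 j (P := predT)) //=.
    have hS := @sum_pow2_le L (d * e j) (mulr_ge0 (ltW d0) (ltW (e0 j))).
    set S := \sum_(l < L | _) _ in hS *; set P := \prod_(i < n.+1 | i != j) e i.
    have P0 : 0 <= P by apply: prodr_ge0 => i _; exact: ltW.
    have -> : 4 ^+ n.+1 * kap ^+ n * (2 * d) * (e j * P) =
              4 ^+ n.+1 * kap ^+ n * (2 * (d * e j)) * P by ring.
    have C0 : 0 <= 4 ^+ n.+1 * kap ^+ n by rewrite !mulr_ge0 ?exprn_ge0 // !mulr_ge0 ?exprn_ge0 // ltW.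
    by rewrite ler_wpM2r // ler_wpM2l.
  by rewrite sumr_const card_ord -[leLHS]mulr_natr /tail_const -/d -/kap le_eqVlt; apply/orP; left; apply/eqP; ring.
- move=> X z oX z0 hz.
  have [l [[i0 hi0] hl]] := int_row_shell z0.
  have [f zE] := box_point_surj hl.
  have oY : orthog_grp R n.+1 (Q *m X).
    by rewrite /orthog_grp /= trmx_mul mulmxA -(mulmxA X^T) oQ mulmx1.
  have [j hj] : exists j, c l <= `|dotp (row j (Q *m X)) (intmx z)|.
    apply: (@orthog_coord_large n _ _ (2 ^+ l) oY); first by rewrite exprn_ge0.
    exists i0; rewrite mxE -intr_norm -natr_absz -natrX.
    by rewrite ler_nat.
  have lj : 2 ^+ l <= d * e j.
    by rewrite mulrC -ler_pdivrMr //; exact: le_trans hj (hz j).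
  have lL : (l < L)%N.
    rewrite ltnS truncn_ge_nat; last by rewrite mulr_ge0 ?sumr_ge0 ?ltW // => i _; exact: ltW.
    apply: (@le_trans _ _ (2 ^+ l)); first by rewrite -natrX ler_nat ltnW // ltn_expl.
    apply: le_trans lj _; rewrite ler_pM2l // (bigD1 j) //= lerDl sumr_ge0 // => i _.
    exact: ltW.
  apply: (sub_bigsetU (i := Ordinal lL)) => //; apply: (sub_bigsetU (i := f)) => //.
  by apply: (sub_bigsetU (i := j)) => //; split => [i _|]; rewrite -zE.
Qed.

End Tail.

(** * Upper bounds for integrals by step functions *)

Section LayerCake.
Local Open Scope ereal_scope.
Context d (T : measurableType d) (R : realType) (mu : {measure set T -> \bar R}).

(* [f] may fail to be measurable: the integral of a nonnegative function is by definition
   the supremum over the simple functions below it. *)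
Lemma ge0_le_lower_integral (D : set T) (f g : T -> \bar R) :
  (forall x, D x -> 0 <= f x) -> (forall x, 0 <= g x) -> (forall x, D x -> f x <= g x) ->
  \int[mu]_(x in D) f x <= \int[mu]_x g x.
Proof.
move=> f0 g0 fg; rewrite ge0_integralE // ge0_integralTE //.
apply: le_ereal_sup => _ [h hf <-]; exists h => // x.
apply: le_trans (hf x) _; rewrite /patch; case: ifPn => [|_]; last exact: g0.
by rewrite inE => /fg.
Qed.

Lemma integral_step_le n (a b : nat -> R) (A : nat -> set T) :
  (forall k, 0 <= a k)%R -> (forall k, measurable (A k)) -> (forall k, mu (A k) <= (b k)%:E) ->
  \int[mu]_x (\sum_(k < n) a k * \1_(A k) x)%:E <= (\sum_(k < n) a k * b k)%:E.
Proof.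
move=> a0 mA hb.
under eq_integral do rewrite -sumEFin.
rewrite (@ge0_integral_sum _ _ _ mu setT measurableT 'I_n (fun k x => (a k * \1_(A k) x)%:E)).
- rewrite -sumEFin; apply: lee_sum => k _.
  under eq_integral do rewrite EFinM.
  rewrite ge0_integralZl_EFin //.
  + by rewrite integral_indic // setIT EFinM lee_wpmul2l // lee_fin.
  + by apply/measurable_EFinP; exact: measurable_indic.
- move=> k; apply/measurable_EFinP; apply: measurable_funM; first exact: measurable_cst.
  exact: measurable_indic.
- by move=> k x _; rewrite lee_fin mulr_ge0 // indicE.
Qed.

End LayerCake.

(** * Tail bound and dyadic summation *)

Section Main.
Variable R : realType.

(** Here p k stands for the indicator of a set containing the event lam > t 2^k. If all these p k
    are 1, the right side is t + t (2^N - 1) = t 2^N. *)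
Lemma dyadic_layers (t lam : R) (N : nat) (p : nat -> R) : 0 < t -> (forall k, 0 <= p k) ->
  lam <= t * 2 ^+ N -> (forall k, t * 2 ^+ k < lam -> p k = 1) ->
  lam <= t + \sum_(k < N) t * 2 ^+ k * p k.
Proof.
move=> t0 p0; elim: N => [|N IH]; first by rewrite expr0 mulr1 big_ord0 addr0.
move=> hN hp; have [h|h] := leP lam (t * 2 ^+ N).
  apply: le_trans (IH h hp) _; rewrite big_ord_recr /= addrA lerDl.
  by rewrite !mulr_ge0 ?exprn_ge0 // ltW.
rewrite (eq_bigr (fun k : 'I_N.+1 => t * 2 ^+ k)) => [|k _]; last first.
  rewrite hp ?mulr1 //; apply: le_lt_trans h; rewrite ler_pM2l // ler_weXn2l ?ler1n //.
  by rewrite -ltnS.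
apply: le_trans hN _; rewrite -mulr_sumr -[X in X + _]mulr1 -mulrDr ler_pM2l //.
by elim: N.+1 => [|k IHk]; rewrite ?big_ord0 ?addr0 // big_ord_recr /= exprS; lra.
Qed.

Lemma sum_inv_pow2_le N : \sum_(k < N) (2 ^+ k)^-1 <= 2 :> R.
Proof.
suff : \sum_(k < N) (2 ^+ k)^-1 <= 2 - 2 / 2 ^+ N :> R.
  by move=> /le_trans; apply; rewrite lerBlDr lerDl divr_ge0 // exprn_ge0.
elim: N => [|N IH]; first by rewrite big_ord0 expr0; lra.
rewrite big_ord_recr /= exprS invfM.
by move: ((2 ^+ N)^-1) IH => q IH; lra.
Qed.

(** Settles d = 1, and bounds the number of dyadic layers for d >= 2. A nonzero integer z has an
    entry of size at least 1, so some coordinate of Q X z is at least 1 / d, which caps T. *)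
Lemma succ_min_orthog_bound n (M Q X : 'M[R]_n.+1) : spd M ->
  orthog_grp R n.+1 Q -> orthog_grp R n.+1 X ->
  succ_min (X^T *m M *m X) n.+1 <= n.+1%:R * 2 ^+ n * \sum_i Num.sqrt (qform M (row i Q)).
Proof.
move=> sM oQ oX; set B := _ * _; set lam := succ_min _ _; rewrite leNgt; apply/negP => hB.
have B0 : 0 <= B by rewrite !mulr_ge0 ?exprn_ge0 ?sumr_ge0 // => i _; exact: sqrtr_ge0.
(* T is the midpoint: below lam for the dual vector to exist, above B for the contradiction. *)
have T0 : 0 < (B + lam) / 2 by lra.
have [|z z0 hz] := @succ_min_orthog_dual R n M Q X _ sM oX T0; first by rewrite -/lam; lra.
have oY : orthog_grp R n.+1 (Q *m X).
  by rewrite /orthog_grp /= trmx_mul mulmxA -(mulmxA X^T) oQ mulmx1.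
have [|j hj] := @orthog_coord_large R n _ (map_mx intr z) 1 oY ler01.
  have [l [[i hi] _]] := int_row_shell z0; exists i; rewrite mxE -intr_norm -natr_absz ler1n.
  by apply: leq_trans hi; rewrite expn_gt0.
have := le_trans hj (hz j); rewrite mulrAC ler_pdivlMr // mulrC mul1r ler_pdivrMr ?ltr0n //.
suff : 2 ^+ n * Num.sqrt (qform M (row j Q)) * n.+1%:R <= B by lra.
by rewrite mulrC mulrA /B ler_wpM2l ?mulr_ge0 ?exprn_ge0 // (bigD1 j) //= lerDl sumr_ge0.
Qed.

(** Squaring leaves 4^n against 2^n; this slack avoids half-integer powers of 2. *)
Lemma prod_sqrt_le n (M Q : 'M[R]_n) : spd M -> \prod_i qform M (row i Q) <= 2 ^+ n * \det M ->
  \prod_i Num.sqrt (qform M (row i Q)) <= 2 ^+ n * Num.sqrt (\det M).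
Proof.
move=> sM h; have dM := spd_det_gt0 sM.
rewrite -ler_sqr ?nnegrE; last 2 first.
- by apply: prodr_ge0 => i _; exact: sqrtr_ge0.
- by rewrite mulr_ge0 ?exprn_ge0 ?sqrtr_ge0.
rewrite -prodrXl exprMn sqr_sqrtr; last exact: ltW.
rewrite (eq_bigr (fun i => qform M (row i Q))) => [|i _]; last by rewrite sqr_sqrtr // spd_ge0.
apply: le_trans h _; rewrite ler_wpM2r ?(ltW dM) // expr2 ler_peMr ?exprn_ge0 //.
by rewrite exprn_ege1 // ler1n.
Qed.

Lemma succ_min_tail n : exists2 K : R, 0 <= K &
  forall mu : {measure set (borelM R n.+1) -> \bar R}, haar_prob mu ->
  forall M : 'M[R]_n.+1, spd M -> forall T, 0 < T ->
  exists2 W : set (borelM R n.+1),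
    measurable W /\ (mu W <= (K * Num.sqrt (\det M) / T ^+ n.+1)%:E)%E &
    forall X : 'M[R]_n.+1, orthog_grp R n.+1 X -> T < succ_min (X^T *m M *m X) n.+1 -> W X.
Proof.
have tc0 : 0 <= tail_const R n by rewrite /tail_const !mulr_ge0 ?exprn_ge0 // !mulr_ge0 // exprn_ge0.
(* (2^n)^(n+1) collects the factors 2^n of the e_i; 2^(n+1) comes from [prod_sqrt_le]. *)
exists (tail_const R n * ((2 ^+ n) ^+ n.+1 * 2 ^+ n.+1)).
  by rewrite !mulr_ge0 ?exprn_ge0.
move=> mu hmu M sM T T0; have [Q oQ hQ] := near_diagonalization sM.
pose e i := 2 ^+ n / T * Num.sqrt (qform M (row i Q)).
have e0 i : 0 < e i.
  by rewrite mulr_gt0 ?divr_gt0 ?exprn_gt0 // sqrtr_gt0; exact: spd_orthog_gt0.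
have [W [mW hW] cW] := lattice_slabs_le hmu oQ e0.
exists W; last first.
  by move=> X oX /(succ_min_orthog_dual Q sM oX T0) [z z0 hz]; exact: cW oX z0 hz.
split=> //; apply: le_trans hW _; rewrite lee_fin.
rewrite /e big_split /= prodr_const card_ord expr_div_n.
have := prod_sqrt_le sM hQ; set P := \prod_i _ => hP.
have T1 : 0 < T ^+ n.+1 by rewrite exprn_gt0.
rewrite ler_pdivlMr //; move: (T ^+ n.+1) T1 => Td T1.
set u := (2 ^+ n) ^+ n.+1.
have -> : tail_const R n * (u / Td * P) * Td = tail_const R n * u * P by field; rewrite gt_eqF.
by rewrite [in leRHS]mulrA -[leRHS]mulrA ler_wpM2l // mulr_ge0 ?exprn_ge0.
Qed.

End Main.

Theorem theorem2 (R : realType) (d : nat) (hd : (1 <= d)%N) :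
  exists C : R,
    forall mu : {measure set (borelM R d) -> \bar R}, haar_prob mu ->
    forall M : 'M[R]_d, spd M ->
      (\int[mu]_(X in orthog_grp R d) (succ_min (X^T *m M *m X) d)%:E
         <= (C * (\det M) `^ ((2 * d)%:R)^-1)%:E)%E.
Proof.
case: d hd => // n _; have [K K0 hK] := succ_min_tail R n.
(* For d >= 2, the 1 is the base layer and 2 K the sum of the dyadic layers. *)
exists (if n is 0%N then 2 else 1 + 2 * K) => mu hmu M sM.
have mu1 : mu setT = 1%E by case: hmu.
have dM := spd_det_gt0 sM.
set t := \det M `^ _.
have t0 : 0 < t by exact: powR_gt0.
have tn : t ^+ n.+1 = Num.sqrt (\det M).
  rewrite -powR_mulrn ?powR_ge0 // -powRrM -powR12_sqrt ?(ltW dM) //; congr (_ `^ _).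
  by rewrite natrM; field.
have f0 X : orthog_grp R n.+1 X -> (0 <= (succ_min (X^T *m M *m X) n.+1)%:E)%E.
  by move=> _; rewrite lee_fin succ_min_ge0.
have [Q oQ hQ] := near_diagonalization sM.
have bound X (oX : orthog_grp R n.+1 X) := succ_min_orthog_bound sM oQ oX.
(* For d = 1, layers of height t 2^k and tail K / 2^k would not sum to a bounded multiple of t; the
   pointwise bound is used instead. *)
case: n => [|n] in hK M sM dM t t0 tn f0 Q oQ hQ bound mu hmu mu1 *.
  apply: le_trans (@ge0_le_lower_integral _ _ R mu _ _ (cst (2 * t)%:E) f0 _ _) _.
  - by move=> X; rewrite lee_fin mulr_ge0 // ltW.
  - move=> X oX; rewrite lee_fin; apply: le_trans (bound X oX) _.
    have := prod_sqrt_le sM hQ; rewrite -tn !big_ord1 !expr1 => h.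
    by rewrite expr0 mulr1 mul1r.
  - by rewrite integral_cst // mu1 mule1.
set B := _ * _ in bound.
(* N is uniform in X, so finitely many layers suffice. *)
have {bound} [N hN] : exists N, forall X, orthog_grp R n.+2 X ->
    succ_min (X^T *m M *m X) n.+2 <= t * 2 ^+ N.
  exists (Num.truncn (B / t)).+1 => X /bound /le_trans; apply.
  rewrite mulrC -ler_pdivrMr //; apply: le_trans (ltW (truncnS_gt _)) _.
  by rewrite -natrX ler_nat ltnW // ltn_expl.
(* At T = t 2^k the factor sqrt(det M) = t^d cancels. *)
have hT k : exists W : set (borelM R n.+2),
    [/\ measurable W, (mu W <= (K / (2 ^+ k) ^+ n.+2)%:E)%E &
    forall X : 'M[R]_n.+2, orthog_grp R n.+2 X ->
      t * 2 ^+ k < succ_min (X^T *m M *m X) n.+2 -> W X].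
  have [|W [mW muW] hW] := hK mu hmu M sM (t * 2 ^+ k); first by rewrite mulr_gt0 ?exprn_gt0.
  exists W; split=> //; rewrite (_ : K / _ = K * Num.sqrt (\det M) / (t * 2 ^+ k) ^+ n.+2) //.
  by rewrite -tn exprMn; field; rewrite !expf_neq0 // gt_eqF.
have [W hW] := choice hT.
(* Layer 0 is the constant t on the whole space; layer k + 1 has height t 2^k on [W k]. *)
pose a k : R := if k is k'.+1 then t * 2 ^+ k' else t.
pose A k : set (borelM R n.+2) := if k is k'.+1 then W k' else setT.
pose b k : R := if k is k'.+1 then K / (2 ^+ k') ^+ n.+2 else 1.
have a0 k : 0 <= a k by case: k => [|k] /=; rewrite ?mulr_ge0 ?exprn_ge0 // ltW.
have mA k : measurable (A k) by case: k => [|k] //=; case: (hW k).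
have hb k : (mu (A k) <= (b k)%:E)%E by case: k => [|k] /=; [rewrite mu1 | case: (hW k)].
apply: le_trans (@ge0_le_lower_integral _ _ R mu _ _
  (fun X => (\sum_(k < N.+1) a k * \1_(A k) X)%:E) f0 _ _) _.
- by move=> X; rewrite lee_fin sumr_ge0 // => k _; rewrite mulr_ge0 // indicE.
- move=> X oX; rewrite lee_fin big_ord_recl /= indicT mulr1.
  apply: (@dyadic_layers R t _ N (fun k => \1_(W k) X) t0) => [k||k hk]; first by rewrite indicE.
    exact: hN.
  by rewrite indicE mem_set //; case: (hW k) => _ _; exact.
have h := @integral_step_le _ _ R mu N.+1 a b A a0 mA hb.
apply: (le_trans h).
rewrite lee_fin big_ord_recl /= mulr1 mulrDl mul1r lerD2l.
apply: (@le_trans _ _ (K * t * \sum_(k < N) (2 ^+ k)^-1)); last first.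
  have -> : 2 * K * t = K * t * 2 by ring.
  by rewrite ler_wpM2l ?mulr_ge0 ?(ltW t0) // sum_inv_pow2_le.
rewrite mulr_sumr; apply: ler_sum => k _.
(* Here d = n + 2 is at least 2: 2^k / 2^(kd) = 2^(-k) 2^(-kn) <= 2^(-k). *)
rewrite (_ : t * 2 ^+ k * (K / (2 ^+ k) ^+ n.+2) = K * t * ((2 ^+ k)^-1 * ((2 ^+ k) ^+ n)^-1)); last first.
  by rewrite !exprS; field; rewrite !expf_neq0.
rewrite ler_wpM2l ?mulr_ge0 ?(ltW t0) // ler_piMr ?invr_ge0 ?exprn_ge0 //.
by rewrite invf_le1 ?exprn_gt0 // !exprn_ege1 // ler1n.
Qed.
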